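(* Let $\omega$ be the Fubini–Study form on $\mathbb{CP}^n$, $\pi_s$ its dual Poisson bivector field, and $\pi_\infty$ the Bruhat Poisson structure on $\mathbb{CP}^n$. Let $$f_j=\frac{\pi_\infty^{\wedge j}\wedge\pi_s^{\wedge(n-j)}}{\pi_s^{\wedge n}},\qquad 1\le j\le n,$$ be the functions arising from the bihamiltonian structure $(\pi_s,\pi_\infty)$. Let $c_k=\sum_{i=1}^kx_i$ for $1\le k\le n$, where $x_1,\dots,x_n$ are the momentum map coordinates on $\mathbb{CP}^n$. Then, up to nonzero constant multiples, the $f_j$ are the elementary symmetric polynomials in $(c_1,\dots,c_n)$: up to a constant multiple, $$f_j=\sum_{i_1<\cdots<i_j}c_{i_1}\cdots c_{i_j},\qquad 1\le j\le n;$$ in particular $f_1=c_1+\cdots+c_n$ and $f_n=c_1\cdots c_n$ up to constant multiples.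
   Context: Let $[Z_0:\cdots:Z_n]$ be homogeneous coordinates on $\mathbb{CP}^n$, and on $\{Z_0\ne0\}$ put $z_i=Z_i/Z_0=r_ie^{\sqrt{-1}\phi_i}$. The (shifted) momentum map coordinates are $$x_i=\delta_{1,i}-\frac{r_i^2}{1+r_1^2+\cdots+r_n^2}=\delta_{1,i}-\frac{|Z_i|^2}{|Z_0|^2+\cdots+|Z_n|^2},\qquad 1\le i\le n.$$ The Fubini–Study form is normalized so that $\omega=\sum_{i=1}^n dx_i\wedge d\phi_i$ on the dense open set where all $Z_i\neq0$; its dual bivector is $\pi_s=\sum_{i=1}^n\partial_{x_i}\wedge\partial_{\phi_i}$ there. The Bruhat Poisson structure $\pi_\infty$ on $\mathbb{CP}^n$ is the smooth Poisson structure whose restriction to the largest Bruhat cell $\{Z_0\ne0\}$ is $$\pi_\infty=\sqrt{-1}\sum_{i=1}^n(1+|y_i|^2)\,\partial_{y_i}\wedge\partial_{\bar y_i},\qquad y_i=\frac{z_i}{\sqrt{1+|z_{i+1}|^2+\cdots+|z_n|^2}},$$ where $y_1,\dots,y_n$ are complex-valued (non-holomorphic) smooth coordinates on this cell and $\partial_{y_i},\partial_{\bar y_i}$ are the associated Wirtinger vector fields. The quotient defining $f_j$ means the unique smooth function with $f_j\,\pi_s^{\wedge n}=\pi_\infty^{\wedge j}\wedge\pi_s^{\wedge(n-j)}$. *)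

(* Defs.v *)
From HB Require Import structures.
From mathcomp Require Import all_boot all_order all_algebra.
From mathcomp Require Import all_classical all_reals all_analysis.
From mathcomp Require Import complex.

Set Implicit Arguments.
Unset Strict Implicit.
Unset Printing Implicit Defensive.

Import Order.TTheory GRing.Theory Num.Theory.
Import numFieldNormedType.Exports.
Import ComplexField.Normc.
Local Open Scope ring_scope.

(** * Exterior algebra *)

(* The exterior algebra of K^m: [u S] is the coefficient of u on the basis
   element e_(s_1) /\ ... /\ e_(s_k), where S = {s_1 < ... < s_k}. *)
Definition extalg (K : comNzRingType) (m : nat) := {ffun {set 'I_m} -> K^o}.

Definition ninv m (A B : {set 'I_m}) : nat :=
  #|[set p : 'I_m * 'I_m | [&& p.1 \in A, p.2 \in B & (p.2 < p.1)%N]]|.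

Definition extprod (K : comNzRingType) m (u v : extalg K m) : extalg K m :=
  [ffun S : {set 'I_m} => \sum_(A : {set 'I_m} | A \subset S)
               (-1) ^+ ninv A (S :\: A) * u A * v (S :\: A)].

Definition extone (K : comNzRingType) m : extalg K m :=
  [ffun S : {set 'I_m} => (S == finset.set0)%:R].

Definition extpow (K : comNzRingType) m (u : extalg K m) (k : nat) :
  extalg K m := iter k (extprod u) (extone K m).

Definition extgen (K : comNzRingType) m (k : 'I_m) : extalg K m :=
  [ffun S : {set 'I_m} => (S == [set k])%:R].

(* A bivector is given by the antisymmetric matrix B of its components
   B k l = <dw_k (x) dw_l, B>; as an element of the exterior algebra it is
   the sum of the B k l e_k /\ e_l over k < l. *)
Definition bivec (K : comNzRingType) m (B : 'M[K]_m) : extalg K m :=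
  \sum_(k < m) \sum_(l < m | (k < l)%N)
    (B k l : K) *: extprod (extgen K k) (extgen K l).

(* Component matrix of u /\ v, for two vectors or for two covectors. *)
Definition wedge2 (K : comNzRingType) m (u v : 'rV[K]_m) : 'M[K]_m :=
  u^T *m v - v^T *m u.

(** * Calculus on R^m *)

Section Calculus.
Variables (R : realType) (m : nat).
Implicit Types f : 'rV[R]_m -> R.

Definition partial (k : 'I_m) f : 'rV[R]_m -> R :=
  fun w => 'D_(delta_mx 0 k) f w.

Fixpoint Ck (k : nat) f : Prop :=
  if k is k'.+1 then
    forall l : 'I_m,
      (forall w, derivable f w (delta_mx 0 l)) /\ Ck k' (partial l f)
  else continuous f.

Definition smooth f : Prop := forall k, Ck k f.

Definition differential f (w : 'rV[R]_m) : 'rV[R]_m := \row_k partial k f w.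

(* The vector field d/dX_k of a coordinate system X, in standard coordinates.
   Row vectors are multiplied by [jacobian X w] on the right, so these are the
   rows of its inverse. *)
Definition coord_field (X : 'rV[R]_m -> 'rV[R]_m) (w : 'rV[R]_m) (k : 'I_m) :
  'rV[R]_m := row k (invmx (jacobian X w)).

End Calculus.

(** * Complex projective space *)

(* Points are the lines through the origin of C^(n+1). *)
Definition CP (R : realType) (n : nat) :=
  {L : {vspace 'rV[R[i]]_n.+1} | (\dim L == 1)%N}.

Section ProjectiveSpace.
Variables (R : realType) (n : nat).

(* C^n is identified with R^(n+n) by (z_i)_i |-> (Re z_i)_i, (Im z_i)_i. *)
Definition zcoord (w : 'rV[R]_(n + n)) (i : 'I_n) : R[i] :=
  Complex (w 0 (lshift n i)) (w 0 (rshift n i)).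

Definition realify (z : 'I_n -> R[i]) : 'rV[R]_(n + n) :=
  row_mx (\row_i complex.Re (z i)) (\row_i complex.Im (z i)).

(* The chart {Z_a <> 0}, with affine coordinates Z_k / Z_a (k <> a): the
   homogeneous coordinates with Z_a = 1 of the point of coordinates w. *)
Definition homog (a : 'I_n.+1) (w : 'rV[R]_(n + n)) : 'rV[R[i]]_n.+1 :=
  \row_k (if unlift a k is Some i then zcoord w i else 1).

Lemma homog_line a w : (\dim <[homog a w]>%VS == 1)%N.
Proof.
rewrite dim_vline eqb1; apply/eqP => /rowP /(_ a).
by rewrite !mxE unlift_none => /eqP; rewrite oner_eq0.
Qed.

Definition chart_point (a : 'I_n.+1) (w : 'rV[R]_(n + n)) : CP R n :=
  exist _ <[homog a w]>%VS (homog_line a w).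

(* Change of coordinates from chart a to chart b, meaningful on
   [chart_dom a b]. *)
Definition chart_dom (a b : 'I_n.+1) (w : 'rV[R]_(n + n)) : Prop :=
  homog a w 0 b != 0.

Definition transition (a b : 'I_n.+1) (w : 'rV[R]_(n + n)) : 'rV[R]_(n + n) :=
  realify (fun i => homog a w 0 (lift b i) / homog a w 0 b).

Definition smooth_fun (f : CP R n -> R) : Prop :=
  forall a, smooth (fun w => f (chart_point a w)).

(* 2-forms and bivector fields are given by their component matrices
   omega(d/dw_k, d/dw_l), resp. pi(dw_k, dw_l), in each of the charts. *)
Definition tensor2 := 'I_n.+1 -> 'rV[R]_(n + n) -> 'M[R]_(n + n).

Definition smooth_antisym (t : tensor2) : Prop :=
  forall a, (forall w, (t a w)^T = - t a w) /\
            (forall k l, smooth (fun w => t a w k l)).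

Definition two_form (omega : tensor2) : Prop :=
  smooth_antisym omega /\
  forall a b w, chart_dom a b w ->
    let J := jacobian (transition a b) w in
    omega a w = J *m omega b (transition a b w) *m J^T.

Definition bivector_field (pi : tensor2) : Prop :=
  smooth_antisym pi /\
  forall a b w, chart_dom a b w ->
    let J := jacobian (transition a b) w in
    pi b (transition a b w) = J^T *m pi a w *m J.

(* Bivector fields satisfying the Jacobi identity
   {w_i, {w_j, w_k}} + cyclic permutations = 0. *)
Definition poisson (pi : tensor2) : Prop :=
  bivector_field pi /\
  forall a w i j k,
    \sum_l (pi a w i l * partial l (fun v => pi a v j k) w +
            pi a w j l * partial l (fun v => pi a v k i) w +
            pi a w k l * partial l (fun v => pi a v i j) w) = 0.

(** * Momentum coordinates and the Fubini-Study form *)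

(* 'I_n indexes 1, ..., n from 0: the i-th coordinate involves Z_(i+1), which
   is component [lift ord0 i] of Z. *)
Definition momentum (i : 'I_n) (p : CP R n) : R :=
  let Z := vpick (val p) in
  (i == 0%N :> nat)%:R
  - normc (Z 0 (lift ord0 i)) ^+ 2 / \sum_k normc (Z 0 k) ^+ 2.

Definition csum (k : 'I_n) (p : CP R n) : R :=
  \sum_(i < n | (i <= k)%N) momentum i p.

(* phi is a smooth enough local choice near w of the arguments of the z_i. *)
Definition local_angles (phi : 'I_n -> 'rV[R]_(n + n) -> R)
    (w : 'rV[R]_(n + n)) : Prop :=
  forall i, differentiable (phi i) w /\
    \forall v \near w,
      zcoord v i = (normc (zcoord v i))%:C%C
                   * Complex (cos (phi i v)) (sin (phi i v)).

(* The smooth 2-form equal to sum_i dx_i /\ dphi_i where no Z_i vanishes; it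
   is determined by its values on this dense open subset of chart 0. *)
Definition fubini_study (omega : tensor2) : Prop :=
  two_form omega /\
  forall w, (forall i, zcoord w i != 0) ->
    exists phi, local_angles phi w /\
      omega ord0 w =
        \sum_i wedge2
          (differential (fun v => momentum i (chart_point ord0 v)) w)
          (differential (phi i) w).

(* The sign is the one for which the dual of sum_i dx_i /\ dphi_i is
   sum_i d/dx_i /\ d/dphi_i. *)
Definition dual_bivector (omega pi : tensor2) : Prop :=
  poisson pi /\ forall a w, (pi a w)^T *m omega a w = 1%:M.

(** * The Bruhat Poisson structure *)

Definition ycoord (w : 'rV[R]_(n + n)) (i : 'I_n) : R[i] :=
  zcoord w i /
  (Num.sqrt (1 + \sum_(k < n | (i < k)%N) normc (zcoord w k) ^+ 2))%:C%C.

(* Re y_i and Im y_i are the coordinates [lshift n i] and [rshift n i] of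
   the system [realify (ycoord _)]. *)
Definition dRe_y (w : 'rV[R]_(n + n)) (i : 'I_n) : 'rV[R[i]]_(n + n) :=
  map_mx (real_complex R)
    (coord_field (fun v => realify (ycoord v)) w (lshift n i)).

Definition dIm_y (w : 'rV[R]_(n + n)) (i : 'I_n) : 'rV[R[i]]_(n + n) :=
  map_mx (real_complex R)
    (coord_field (fun v => realify (ycoord v)) w (rshift n i)).

Definition d_y w i : 'rV[R[i]]_(n + n) :=
  2^-1 *: (dRe_y w i - 'i%C *: dIm_y w i).

Definition d_ybar w i : 'rV[R[i]]_(n + n) :=
  2^-1 *: (dRe_y w i + 'i%C *: dIm_y w i).

(* Chart 0 is the largest Bruhat cell, which is dense. *)
Definition bruhat (pi : tensor2) : Prop :=
  poisson pi /\
  forall w, map_mx (real_complex R) (pi ord0 w) =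
    'i%C *: \sum_i (1 + normc (ycoord w i) ^+ 2)%:C%C
                     *: wedge2 (d_y w i) (d_ybar w i).

(* f is the quotient of pi_inf^j /\ pi_s^(n-j) by pi_s^n. *)
Definition bihamiltonian_quotient (pi_s pi_inf : tensor2) (j : nat)
    (f : CP R n -> R) : Prop :=
  smooth_fun f /\
  forall a w,
    f (chart_point a w) *: extpow (bivec (pi_s a w)) n =
    extprod (extpow (bivec (pi_inf a w)) j)
            (extpow (bivec (pi_s a w)) (n - j)).

End ProjectiveSpace.

(* Main.v *)
Require Import Defs.
From HB Require Import structures.
From mathcomp Require Import all_boot all_order all_algebra.
From mathcomp Require Import ring.

Set Implicit Arguments.
Unset Strict Implicit.
Unset Printing Implicit Defensive.

Import Order.TTheory GRing.Theory Num.Theory.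
Local Open Scope ring_scope.

(* Put T_k = 1 + |z_k|^2 + ... + |z_n|^2, so that c_k = T_(k+1) / T_1 and
   1 + |y_k|^2 = T_k / T_(k+1) = c_(k-1) / c_k. In the coordinates c_k and their
   conjugate angles psi_k = phi_k - phi_(k+1), valid where no Z_i vanishes,
   pi_s = sum_k d/dc_k /\ d/dpsi_k and pi_inf = sum_k c_k d/dc_k /\ d/dpsi_k.
   The bivectors w_k = d/dc_k /\ d/dpsi_k commute and have square zero, hence
   pi_inf^j /\ pi_s^(n-j) = j! (n-j)! e_j(c) w_1 ... w_n, while
   pi_s^n = n! w_1 ... w_n, which gives f_j = e_j(c) / C(n, j) on a dense set;
   both sides are continuous. *)

(** * The exterior algebra as a ring *)

(** The diagonal form of pi_inf rests on theta_i = log (1 + |y_i|^2). Since c_k is the product of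
    the exp (- theta_i) for i <= k, dc_k = - c_k (dtheta_1 + ... + dtheta_k). For the bivector with
    weights c_k, the factor c_k of the weight cancels the one in dc_k, which leaves {theta_i, phi_j}
    = - delta_ij and {theta_i, theta_j} = {phi_i, phi_j} = 0. As phi_i is also the argument of y_i,
    these constant brackets determine those of Re y_i and Im y_i, and they are the ones that define
    pi_inf. The argument is pointwise linear algebra on matrices of differentials: the angles psi_k
    and the logarithms theta_i enter only through their differentials, and no coordinate system (c,
    psi) has to be constructed. The comparison of coefficients needs w_1 ... w_n to be nonzero,
    which is why the exterior powers of a spanning family are studied. *)

Section ExteriorAlgebra.
Variables (K : comNzRingType) (m : nat).
Implicit Types (A B C S : {set 'I_m}) (u v w : extalg K m).
Local Notation set0 := finset.set0.

HB.instance Definition _ := GRing.Lmodule.on (extalg K m).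

Definition extbasis A : extalg K m := [ffun S : {set 'I_m} => (S == A)%:R].

Lemma extbasis_sum u : u = \sum_A (u A : K) *: extbasis A.
Proof.
apply/ffunP => S; rewrite sum_ffunE (bigD1 S) //= big1 => [|A AS].
  by rewrite addr0 !ffunE eqxx; rewrite /GRing.scale /= mulr1.
by rewrite !ffunE eq_sym (negPf AS) scaler0.
Qed.

(** Additivity of the inversion count in each argument is what makes the two sign exponents of
    [extprodA] agree. *)
Lemma ninvUl A B C : [disjoint A & B] ->
  ninv (A :|: B) C = (ninv A C + ninv B C)%N.
Proof.
move=> dAB; rewrite /ninv.
set X := [set _ | _ ]; set Y := [set _ | _]; set Z := [set _ | _].
have -> : X = (Y :|: Z)%SET.
  by apply/setP => p; rewrite !inE; case: (p.1 \in A); case: (p.1 \in B);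
    rewrite ?orbF ?orbb.
rewrite cardsU (_ : (Y :&: Z)%SET = finset.set0) ?cards0 ?subn0 //.
apply/setP => p; rewrite !inE; apply/negP => /andP[/and3P[pA _ _] /and3P[pB _ _]].
by move: (disjointFr dAB pA); rewrite pB.
Qed.

Lemma ninvUr A B C : [disjoint B & C] ->
  ninv A (B :|: C) = (ninv A B + ninv A C)%N.
Proof.
move=> dAB; rewrite /ninv.
set X := [set _ | _ ]; set Y := [set _ | _]; set Z := [set _ | _].
have -> : X = (Y :|: Z)%SET.
  by apply/setP => p; rewrite !inE; case: (p.1 \in A);
    case: (p.2 \in B); case: (p.2 \in C); rewrite ?orbF ?orbb.
rewrite cardsU (_ : (Y :&: Z)%SET = finset.set0) ?cards0 ?subn0 //.
apply/setP => p; rewrite !inE; apply/negP => /andP[/and3P[_ pA _] /and3P[_ pB _]].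
by move: (disjointFr dAB pA); rewrite pB.
Qed.

Lemma extprod_linl a u v w :
  extprod (a *: u + v) w = a *: extprod u w + extprod v w.
Proof.
apply/ffunP => S; rewrite !ffunE scaler_sumr -big_split /=; apply: eq_bigr => A _.
by rewrite !ffunE /GRing.scale /=; ring.
Qed.

Lemma extprod_linr a u v w :
  extprod w (a *: u + v) = a *: extprod w u + extprod w v.
Proof.
apply/ffunP => S; rewrite !ffunE scaler_sumr -big_split /=; apply: eq_bigr => A _.
by rewrite !ffunE /GRing.scale /=; ring.
Qed.

Lemma extprodDl u v w : extprod (u + v) w = extprod u w + extprod v w.
Proof. by rewrite -[u]scale1r extprod_linl !scale1r. Qed.

Lemma extprodDr w u v : extprod w (u + v) = extprod w u + extprod w v.
Proof. by rewrite -[u]scale1r extprod_linr !scale1r. Qed.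

Lemma extprod0l u : extprod 0 u = 0.
Proof. by apply: (addIr (extprod 0 u)); rewrite -extprodDl !add0r. Qed.

Lemma extprod0r u : extprod u 0 = 0.
Proof. by apply: (addIr (extprod u 0)); rewrite -extprodDr !add0r. Qed.

Lemma extprodZl a u v : extprod (a *: u) v = a *: extprod u v.
Proof. by have := extprod_linl a u 0 v; rewrite extprod0l !addr0. Qed.

Lemma extprodZr a u v : extprod u (a *: v) = a *: extprod u v.
Proof. by have := extprod_linr a v 0 u; rewrite extprod0r !addr0. Qed.

Lemma extprod_suml I (r : seq I) (P : pred I) (F : I -> extalg K m) v :
  extprod (\sum_(i <- r | P i) F i) v = \sum_(i <- r | P i) extprod (F i) v.
Proof.
by apply: (big_morph (fun x => extprod x v)) => [x y|];
  rewrite ?extprodDl ?extprod0l.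
Qed.

Lemma extprod_sumr I (r : seq I) (P : pred I) (F : I -> extalg K m) v :
  extprod v (\sum_(i <- r | P i) F i) = \sum_(i <- r | P i) extprod v (F i).
Proof.
by apply: (big_morph (extprod v)) => [x y|]; rewrite ?extprodDr ?extprod0r.
Qed.

Lemma extprod_basis A B :
  extprod (extbasis A) (extbasis B) =
  if [disjoint A & B] then (-1) ^+ ninv A B *: extbasis (A :|: B) else 0.
Proof.
apply/ffunP => S; rewrite ffunE.
case: ifPn => [dAB|ndAB]; rewrite !ffunE.
  case: (S =P A :|: B) => [->|SAB].
    rewrite (bigD1 A) ?subsetUl //= big1 => [|C /andP[_ CA]]; last first.
      by rewrite !ffunE (negPf CA) mulr0 mul0r.
    have -> : ((A :|: B) :\: A)%SET = B.
      by rewrite setDUl setDv set0U; apply/setDidPl; rewrite disjoint_sym.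
    by rewrite !ffunE !eqxx addr0 mulr1.
  rewrite scaler0 big1 // => C CS; rewrite !ffunE.
  case: (C =P A) => [CA|]; last by rewrite mulr0 mul0r.
  case: (_ =P B) => [CB|]; last by rewrite mulr0.
  by case: SAB; rewrite -CB -CA setDE setUIr setUCr setIT; apply/esym/setUidPr.
rewrite big1 // => C CS; rewrite !ffunE.
case: (C =P A) => [CA|]; last by rewrite mulr0 mul0r.
case: (_ =P B) => [CB|]; last by rewrite mulr0.
by case/negP: ndAB; rewrite -CB -CA -setI_eq0 setDE setICA setICr setI0.
Qed.

Lemma extprodA : associative (@extprod K m).
Proof.
move=> u v w.
(* Trilinearity reduces the claim to basis elements, where both sides vanish unless A, B, C are
   pairwise disjoint. *)
rewrite (extbasis_sum u) (extbasis_sum v) (extbasis_sum w).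
rewrite [LHS]extprod_suml [in RHS]extprod_suml [RHS]extprod_suml.
apply: eq_bigr => A _.
rewrite [in LHS]extprod_suml [LHS]extprod_sumr [X in _ = extprod X _]extprod_sumr [RHS]extprod_suml.
apply: eq_bigr => B _.
rewrite [in LHS]extprod_sumr [LHS]extprod_sumr [RHS]extprod_sumr.
apply: eq_bigr => C _.
rewrite !(extprodZl, extprodZr) !scalerA .
rewrite [X in _ = X *: _](_ : _ = u A * v B * w C); last by rewrite -mulrA mulrC.
congr (_ *: _).
rewrite !extprod_basis.
case dAB: [disjoint A & B]; case dBC: [disjoint B & C];
  rewrite ?extprod0l ?extprod0r ?extprodZl ?extprodZr ?extprod_basis //;
  rewrite -!setI_eq0 ?setIUr ?setIUl ?setU_eq0 !setI_eq0 ?dAB ?dBC ?andbF ?andbT ?scaler0 //.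
case dAC: [disjoint A & C]; rewrite /= ?scaler0 //.
rewrite !scalerA -!exprD ninvUl // ninvUr // setUA.
by rewrite [X in _ ^+ X]addnC -addnA.
Qed.

Lemma ninv0l A : ninv set0 A = 0%N.
Proof. by apply/eqP; rewrite cards_eq0; apply/eqP/setP => p; rewrite !inE. Qed.

Lemma ninv0r A : ninv A set0 = 0%N.
Proof.
by apply/eqP; rewrite cards_eq0; apply/eqP/setP => p; rewrite !inE andbF.
Qed.

Lemma extprod1l : left_id (extone K m) (@extprod K m).
Proof.
move=> u; rewrite {1}(extbasis_sum u) extprod_sumr [RHS]extbasis_sum.
apply: eq_bigr => A _; rewrite extprodZr (extprod_basis set0).
by rewrite -setI_eq0 set0I eqxx ninv0l scale1r set0U.
Qed.

Lemma extprod1r : right_id (extone K m) (@extprod K m).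
Proof.
move=> u; rewrite {1}(extbasis_sum u) extprod_suml [RHS]extbasis_sum.
apply: eq_bigr => A _; rewrite extprodZl (extprod_basis _ set0).
by rewrite -setI_eq0 setI0 eqxx ninv0r scale1r setU0.
Qed.

Lemma extone_neq0 : extone K m != 0.
Proof. by apply/eqP => /ffunP /(_ set0); rewrite !ffunE eqxx => /eqP; rewrite oner_eq0. Qed.

HB.instance Definition _ := GRing.Zmodule_isNzRing.Build (extalg K m)
  extprodA extprod1l extprod1r extprodDl extprodDr extone_neq0.
HB.instance Definition _ := GRing.Lmodule_isLalgebra.Build K (extalg K m)
  (fun a u v => esym (extprodZl a u v)).
HB.instance Definition _ := GRing.Lalgebra_isAlgebra.Build K (extalg K m)
  (fun a u v => esym (extprodZr a u v)).

Lemma extprodE u v : extprod u v = u * v.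
Proof. by []. Qed.

Lemma extpowE u k : extpow u k = u ^+ k.
Proof. by elim: k => // k IH; rewrite exprS -IH. Qed.

Lemma extgenE k : extgen K k = extbasis [set k].
Proof. by []. Qed.

Lemma ninv1 (k l : 'I_m) : ninv [set k] [set l] = (l < k)%N.
Proof.
rewrite /ninv.
have -> : [set p : 'I_m * 'I_m | [&& p.1 \in [set k], p.2 \in [set l] & (p.2 < p.1)%N]]%SET =
   if (l < k)%N then [set (k, l)]%SET else set0.
  apply/setP => -[x y]; case: ifP => lk; rewrite !inE /=.
    by rewrite xpair_eqE; case: eqP => //= ->; case: eqP => //= ->.
  by case: eqP => //= ->; case: eqP => //= ->.
by case: ifP; rewrite ?cards1 ?cards0.
Qed.

Lemma extgenN (k l : 'I_m) : extgen K k * extgen K l = - (extgen K l * extgen K k).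
Proof.
rewrite !extgenE /GRing.mul /= !extprod_basis.
rewrite [[disjoint [set l] & _]]disjoint_sym !ninv1.
case: ifP; last by rewrite oppr0.
rewrite -setI_eq0 => /eqP/setP/(_ k); rewrite !inE eqxx /= => /negbT kl.
rewrite setUC.
case: ltngtP => [_|_|/val_inj lk]; first by rewrite expr1 expr0 scaleN1r scale1r.
  by rewrite expr1 expr0 scaleN1r scale1r opprK.
by rewrite lk eqxx in kl.
Qed.

Lemma extgen_sq (k : 'I_m) : extgen K k * extgen K k = 0.
Proof.
by rewrite !extgenE /GRing.mul /= !extprod_basis -setI_eq0 setIid -cards_eq0 cards1.
Qed.

(** * Vectors and bivectors as elements of the exterior algebra *)

Definition extvec (u : 'rV[K]_m) : extalg K m := \sum_k (u 0 k : K) *: extgen K k.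

Lemma extvec_is_linear : linear extvec.
Proof.
move=> a u v; rewrite /extvec scaler_sumr -big_split; apply: eq_bigr => k _.
by rewrite /= !mxE scalerDl scalerA.
Qed.

HB.instance Definition _ :=
  GRing.isLinear.Build K 'rV[K]_m (extalg K m) _ extvec extvec_is_linear.

Lemma extvecN (x y : 'rV[K]_m) :
  extvec x * extvec y = - (extvec y * extvec x).
Proof.
rewrite /extvec !mulr_suml -sumrN.
under eq_bigr do rewrite mulr_sumr.
under [RHS]eq_bigr do rewrite mulr_sumr -sumrN.
rewrite exchange_big; apply: eq_bigr => k _; apply: eq_bigr => l _ /=.
by rewrite -!(scalerAl, scalerAr) extgenN !scalerA mulrC !scalerN.
Qed.

(** A product of two vectors runs over all pairs of indices, [bivec] over pairs k < l only; this
    regrouping isolates the diagonal, which vanishes, and joins the two orders of each pair. *)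
Lemma sum_pairs (V : zmodType) (F : 'I_m -> 'I_m -> V) :
  \sum_k \sum_l F k l =
  \sum_k F k k + \sum_(k < m) \sum_(l < m | (k < l)%N) (F k l + F l k).
Proof.
have -> : \sum_k \sum_l F k l = \sum_(k < m) (F k k + (\sum_(l < m | (k < l)%N) F k l
     + \sum_(l < m | (l < k)%N) F k l)).
  apply: eq_bigr => k _; rewrite (bigD1 k) //=; congr (_ + _).
  rewrite (bigID (fun l : 'I_m => (k < l)%N)) /=; congr (_ + _);
    by apply: eq_bigl => l; rewrite -val_eqE /=; case: ltngtP.
rewrite !big_split /=; congr (_ + _).
rewrite [X in _ + X](exchange_big_dep predT) //= -big_split /=.
by apply: eq_bigr => k _; rewrite -big_split.
Qed.

Lemma extvecM (x y : 'rV[K]_m) :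
  extvec x * extvec y =
  \sum_k \sum_l (x 0 k * y 0 l : K) *: (extgen K k * extgen K l).
Proof.
rewrite /extvec mulr_suml; apply: eq_bigr => k _.
rewrite mulr_sumr; apply: eq_bigr => l _.
by rewrite -scalerAl -scalerAr scalerA.
Qed.

Lemma extvec_sq (x : 'rV[K]_m) : extvec x * extvec x = 0.
Proof.
rewrite extvecM sum_pairs big1 => [|k _]; last by rewrite extgen_sq scaler0.
rewrite big1 ?addr0 // => k _; rewrite big1 // => l _.
by rewrite [_ * extgen K k]extgenN mulrC scalerN subrr.
Qed.

Lemma bivec_wedge2 (x y : 'rV[K]_m) : bivec (wedge2 x y) = extvec x * extvec y.
Proof.
rewrite extvecM sum_pairs [X in X + _]big1 => [|k _]; last first.
  by rewrite extgen_sq scaler0.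
rewrite add0r; apply: eq_bigr => k _; apply: eq_bigr => l _.
rewrite [extgen K l * _]extgenN scalerN -scalerBl; congr (_ *: _).
by rewrite !mxE !big_ord1 !mxE [y 0 k * _]mulrC.
Qed.

Lemma bivec_is_linear : linear (@bivec K m).
Proof.
move=> a B C; rewrite /bivec scaler_sumr -big_split; apply: eq_bigr => k _ /=.
rewrite scaler_sumr -big_split; apply: eq_bigr => l _ /=.
by rewrite !mxE scalerDl scalerA.
Qed.

HB.instance Definition _ :=
  GRing.isLinear.Build K 'M[K]_m (extalg K m) _ (@bivec K m) bivec_is_linear.

End ExteriorAlgebra.

(* The [w i] commute for [b = 0] and anticommute for [b = 1]. *)
Section SquareZeroProducts.
Variables (T : finType) (A : nzRingType) (b : nat) (w : T -> A) (r : seq T).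
Hypotheses (r_uniq : uniq r) (r_full : forall t, t \in r).
Hypothesis w_sign : forall i j, w i * w j = (-1) ^+ b * (w j * w i).
Hypothesis w_sq : forall i, w i * w i = 0.
Implicit Types (I J : {set T}).

(** The list [r] fixes the order of the factors, on which the sign depends in the anticommuting
    case. *)
Definition setprod I : A := \prod_(i <- r | i \in I) w i.

(** Moving [w k] to its place in the list passes some number [p] of factors, each at the cost of
    [(-1) ^+ b]. *)
Lemma setprodU1 k I : k \notin I ->
  exists p, w k * setprod I = (-1) ^+ (b * p) * setprod (k |: I).
Proof.
rewrite /setprod => kI; move: (r_full k) r_uniq.
elim: r => [//|i s IHs]; rewrite inE => /predU1P[<-|ks] /= /andP[iNs us].
  exists 0%N; rewrite muln0 mul1r !big_cons setU11 (negPf kI); congr (_ * _).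
  rewrite big_seq_cond [RHS]big_seq_cond; apply: eq_bigl => j; rewrite !inE.
  by case: eqP => // ->; rewrite (negPf iNs).
have [p IHp] := IHs ks us; rewrite !big_cons !inE.
have -> /= : (i == k) = false by apply: contraNF iNs => /eqP ->.
case: ifP => iI; last by exists p.
exists p.+1; rewrite mulrA w_sign -!mulrA IHp mulnS exprD -!mulrA.
by congr (_ * _); rewrite !mulrA commr_sign.
Qed.

Lemma setprod_mem k I : k \in I -> w k * setprod I = 0.
Proof.
move=> kI; have [p] := @setprodU1 k (I :\ k) (negbT (setD11 _ _)).
rewrite setD1K // => /(congr1 ( *%R (w k))); rewrite mulrA w_sq mul0r.
rewrite mulrA commr_sign -mulrA => /esym/(congr1 ( *%R ((-1) ^+ (b * p)))).
by rewrite mulr0 signrMK.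
Qed.

End SquareZeroProducts.

(** * Powers of bivectors *)

(** Double counting: an element k of J together with a q-subset avoiding it is a (q+1)-subset with a
    marked element. *)
Lemma sum_setD1 (T : finType) (V : nmodType) (J : {set T}) q
    (F : T -> {set T} -> V) :
  \sum_(k in J) \sum_(I : {set T} | (I \subset J :\ k) && (#|I| == q)) F k I =
  \sum_(I : {set T} | (I \subset J) && (#|I| == q.+1)) \sum_(k in I) F k (I :\ k).
Proof.
rewrite [RHS](exchange_big_dep (mem J)) /=; last first.
  by move=> I k /andP[/subsetP IJ _] /IJ.
apply: eq_bigr => k kJ.
rewrite (reindex_onto (fun I => I :\ k) (fun I => k |: I)) /=; last first.
  by move=> I /andP[/subsetD1P[_ kI] _]; rewrite setU1K.
apply: eq_bigl => I; apply/idP/idP.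
  move=> /andP[/andP[IJ cI] /eqP IE].
  have kI : k \in I by rewrite -IE setU11.
  move: cI; rewrite (cardsD1 k I) kI /= add1n eqSS => ->.
  by rewrite !andbT -IE subUset sub1set kJ (subset_trans IJ) ?subsetDl.
move=> /andP[/andP[IJ cI] kI].
by rewrite setSD // setD1K // eqxx andbT; move: cI; rewrite (cardsD1 k I) kI.
Qed.

(** Each (q+1)-set is obtained once for each choice of its marked element, hence the factor q+1. *)
Lemma esym_rec (T : finType) (K : comNzRingType) (a : T -> K) (J : {set T}) q :
  \sum_(k in J) a k *
    (\sum_(I : {set T} | (I \subset J :\ k) && (#|I| == q)) \prod_(i in I) a i) =
  q.+1%:R * \sum_(I : {set T} | (I \subset J) && (#|I| == q.+1)) \prod_(i in I) a i.
Proof.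
under eq_bigr do rewrite mulr_sumr.
rewrite sum_setD1 mulr_sumr; apply: eq_bigr => I /andP[_ /eqP cI].
have aI k : k \in I -> a k * \prod_(i in I :\ k) a i = \prod_(i in I) a i.
  by move=> kI; rewrite [RHS](big_setD1 k).
rewrite (eq_bigr _ aI).
by rewrite sumr_const cI mulr_natl.
Qed.

Lemma setprod0 (T : finType) (A : nzRingType) (w : T -> A) r :
  setprod w r finset.set0 = 1.
Proof. by rewrite /setprod big_pred0 // => i; rewrite inE. Qed.

Section SquareZeroPowers.
Variables (K : comNzRingType) (A : algType K) (T : finType) (w : T -> A) (r : seq T).
Hypotheses (r_uniq : uniq r) (r_full : forall t, t \in r).
Hypothesis w_comm : forall i j, w i * w j = w j * w i.
Hypothesis w_sq : forall i, w i * w i = 0.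
Implicit Types (I J : {set T}) (a : T -> K).
Local Notation W := (setprod w r).

Let setprodU1_comm k I : k \notin I -> w k * W I = W (k |: I).
Proof.
move=> /(@setprodU1 T A 0 w r r_uniq r_full)[i j|p ->]; last by rewrite mul1r.
by rewrite mul1r.
Qed.

Let setprod_mem_comm k I : k \in I -> w k * W I = 0.
Proof.
by apply: (@setprod_mem T A 0 w r r_uniq r_full) => // i j; rewrite mul1r.
Qed.

(** The terms with k in J vanish because [w k] has square zero; the others are grouped by the union
    of J and k. *)
Lemma mul_setprods a q (g : {set T} -> K) :
  (\sum_k a k *: w k) * (\sum_(J : {set T} | #|J| == q) g J *: W J) =
  \sum_(J : {set T} | #|J| == q.+1) (\sum_(k in J) a k * g (J :\ k)) *: W J.
Proof.
rewrite mulr_suml.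
transitivity (\sum_(k in [set: T])
   \sum_(J : {set T} | (J \subset [set: T] :\ k) && (#|J| == q)) (a k * g J) *: W (k |: J)).
  apply: eq_big => [k|k _]; first by rewrite inE.
  rewrite mulr_sumr (bigID (fun J : {set T} => k \in J)) /= big1 ?add0r => [|J].
    apply: eq_big => J; first by rewrite subsetD1 subsetT /= andbC.
    by case/andP=> _ kJ; rewrite -scalerAl -scalerAr scalerA setprodU1_comm.
  by case/andP=> _ kJ; rewrite -scalerAl -scalerAr setprod_mem_comm // !scaler0.
rewrite sum_setD1; apply: eq_big => [J|J _]; first by rewrite subsetT.
by rewrite scaler_suml; apply: eq_bigr => k kJ; rewrite setD1K.
Qed.

(** The factor q! counts the orders in which the elements of I can be drawn from the q equal
    factors. *)
Lemma exp_mul_setprods a q p :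
  (\sum_k a k *: w k) ^+ q * (\sum_(J : {set T} | #|J| == p) W J) =
  q`!%:R *: (\sum_(J : {set T} | #|J| == (q + p)%N)
    (\sum_(I : {set T} | (I \subset J) && (#|I| == q)) \prod_(i in I) a i) *: W J).
Proof.
elim: q => [|q IHq].
  rewrite mul1r fact0 scale1r; apply: eq_bigr => J _.
  rewrite (bigD1 finset.set0) ?sub0set ?cards0 //= big_set0 big1 ?addr0 ?scale1r // => I.
  by case/andP=> /andP[_ /eqP/cards0_eq ->]; rewrite eqxx.
rewrite exprS -mulrA IHq -scalerAr mul_setprods !scaler_sumr addSn.
apply: eq_bigr => J _; rewrite esym_rec !scalerA; congr (_ *: _).
by rewrite mulrA -natrM factS mulnC.
Qed.

Lemma exp_mul_exp a p q : (q + p = #|T|)%N ->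
  (\sum_k a k *: w k) ^+ q * (\sum_k w k) ^+ p =
  ((q`! * p`!)%:R * \sum_(I : {set T} | #|I| == q) \prod_(i in I) a i)
    *: \prod_(i <- r) w i.
Proof.
move=> qp.
have -> : (\sum_k w k) ^+ p = p`!%:R *: \sum_(J : {set T} | #|J| == p) W J.
  (* Size 0 reduces the second factor to 1, and with all weights 1 the only subset I = J contributes
     1, which expands the plain power. *)
  have := exp_mul_setprods (fun=> 1) p 0.
  rewrite (bigD1 finset.set0) ?cards0 //= [X in _ + X]big1 => [|I /andP[]]; last first.
    by move=> /eqP/cards0_eq ->; rewrite eqxx.
  rewrite setprod0 addr0 mulr1 addn0; under eq_bigr do rewrite scale1r.
  move=> ->; congr (_ *: _); apply: eq_bigr => J /eqP cJ.
  rewrite (bigD1 J) ?subxx ?cJ //= big1_eq big1 ?addr0 ?scale1r // => I.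
  by case/andP=> /andP[IJ cI]; rewrite -subset_leqif_cards // (eqP cI) cJ eqxx.
rewrite -scalerAr exp_mul_setprods qp natrM -mulrA mulrCA -!scalerA; congr (_ *: (_ *: _)).
rewrite (big_pred1 [set: T]) => [|J]; last first.
  by rewrite -cardsT (subset_leqif_cards (subsetT _)).
rewrite /setprod; congr (_ *: _); first by apply: eq_bigl => I; rewrite subsetT.
by apply: eq_bigl => i; rewrite inE.
Qed.

End SquareZeroPowers.

(** * Nonvanishing of the top product of a spanning family *)

Section ExteriorBasis.
Variables (K : comNzRingType) (m : nat) (T : finType) (x : T -> 'rV[K]_m) (r : seq T).
Hypotheses (r_uniq : uniq r) (r_full : forall t, t \in r) (cTm : #|T| = m).
Hypothesis x_span : forall k, exists a : T -> K, delta_mx 0 k = \sum_t a t *: x t.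
Local Notation V := (setprod (fun t => extvec (x t)) r).

Let vspan q (u : extalg K m) : Prop :=
  exists g : {set T} -> K, u = \sum_(J : {set T} | #|J| == q) g J *: V J.

Lemma extvec_delta (k : 'I_m) : extvec (delta_mx 0 k : 'rV[K]_m) = extgen K k.
Proof.
rewrite /extvec (bigD1 k) //= big1 => [|l lk]; last by rewrite mxE (negPf lk) andbF scale0r.
by rewrite mxE !eqxx scale1r addr0.
Qed.

Lemma vspan_sum q I (s : seq I) (P : pred I) (F : I -> extalg K m) :
  (forall i, P i -> vspan q (F i)) -> vspan q (\sum_(i <- s | P i) F i).
Proof.
move=> FP; apply: big_ind => //.
  by exists (fun=> 0); rewrite big1 // => J _; rewrite scale0r.
move=> u1 u2 [g1 ->] [g2 ->]; exists (fun J => g1 J + g2 J).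
by rewrite -big_split; apply: eq_bigr => J _; rewrite scalerDl.
Qed.

Lemma vspan_scale q a u : vspan q u -> vspan q (a *: u).
Proof.
move=> [g ->]; exists (fun J => a * g J).
by rewrite scaler_sumr; apply: eq_bigr => J _; rewrite scalerA.
Qed.

Lemma vspan_setprod (J : {set T}) : vspan #|J| (V J).
Proof.
exists (fun I => (I == J)%:R); rewrite (bigD1 J) //= eqxx scale1r big1 ?addr0 // => I.
by case/andP=> _ /negPf ->; rewrite scale0r.
Qed.

Lemma vspan_extvecM t q u : vspan q u -> vspan q.+1 (extvec (x t) * u).
Proof.
move=> [g ->]; rewrite mulr_sumr; apply: vspan_sum => J /eqP cJ.
rewrite -scalerAr; apply: vspan_scale.
have sgn i j : extvec (x i) * extvec (x j) = (-1) ^+ 1 * (extvec (x j) * extvec (x i)).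
  by rewrite expr1 mulN1r extvecN.
have [tJ|tJ] := boolP (t \in J).
  rewrite (setprod_mem r_uniq r_full sgn) // => [|i]; last exact: extvec_sq.
  by exists (fun=> 0); rewrite big1 // => I; rewrite scale0r.
have [p ->] := setprodU1 r_uniq r_full sgn tJ.
rewrite -signr_odd mulr_sign -scaler_sign; apply: vspan_scale.
by rewrite -cJ -add1n -[1%N]/(nat_of_bool true) -tJ -cardsU1; apply: vspan_setprod.
Qed.

(** Induction on the size of S: one generator is split off up to sign and expanded in the family
    [x]. *)
Lemma vspan_basis (S : {set 'I_m}) : vspan #|S| (extbasis K S).
Proof.
move: {2}#|S| (erefl #|S|) => q; elim: q S => [|q IHq] S cS.
  exists (fun=> 1); rewrite cS (cards0_eq cS) (bigD1 finset.set0) ?cards0 //=.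
  rewrite scale1r big1 => [|J /andP[/eqP/cards0_eq ->]]; last by rewrite eqxx.
  by rewrite addr0 setprod0.
have /card_gt0P[k kS] : (0 < #|S|)%N by rewrite cS.
have cSk : #|S :\ k| = q by move: cS; rewrite (cardsD1 k S) kS; case.
have dk : [disjoint [set k] & S :\ k] by rewrite disjoints1 setD11.
have -> : extbasis K S = (-1) ^+ ninv [set k] (S :\ k) *: (extgen K k * extbasis K (S :\ k)).
  by rewrite /GRing.mul /= extgenE extprod_basis dk signrZK setD1K.
apply: vspan_scale; have [a] := x_span k.
move=> /(congr1 (@extvec K m)); rewrite extvec_delta linear_sum => ->.
rewrite mulr_suml; apply: vspan_sum => t _; rewrite linearZ -scalerAl.
by apply: vspan_scale; rewrite cS -cSk; apply/vspan_extvecM/IHq.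
Qed.

(** In top degree a single product of the family remains, and the basis element of the full set is a
    multiple of it; it cannot vanish. *)
Lemma ext_volume_neq0 : \prod_(t <- r) extvec (x t) != 0.
Proof.
apply/eqP => prod0; have [g] := vspan_basis [set: 'I_m].
rewrite cardsT card_ord (big_pred1 [set: T]) => [|J]; last first.
  by rewrite -cTm -cardsT (subset_leqif_cards (subsetT _)).
rewrite /setprod (eq_bigl predT) => [|t]; last by rewrite inE.
by rewrite prod0 scaler0 => /ffunP/(_ [set: 'I_m]) /eqP; rewrite !ffunE eqxx oner_eq0.
Qed.

End ExteriorBasis.

(** * Simultaneous Darboux frames *)

Lemma bihamiltonian_pencil (F : numFieldType) n (A B : 'M[F]_(n, n + n))
    (c : 'I_n -> F) (P Q : 'M[F]_(n + n)) j a : (j <= n)%N ->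
  col_mx A B \in unitmx ->
  P = \sum_i wedge2 (row i A) (row i B) ->
  Q = \sum_i c i *: wedge2 (row i A) (row i B) ->
  a *: extpow (bivec P) n = extprod (extpow (bivec Q) j) (extpow (bivec P) (n - j)) ->
  'C(n, j)%:R * a = \sum_(I : {set 'I_n} | #|I| == j) \prod_(i in I) c i.
Proof.
move=> jn ABu PE QE.
pose T : finType := ('I_n * bool)%type.
pose x (t : T) := if t.2 then row t.1 B else row t.1 A.
(* The two vectors of each pair are adjacent in this list, so the product of the [w k] is the
   product of all the vectors without any sign. *)
pose r : seq T := [seq (k, b) | k <- enum 'I_n, b <- [:: false; true]].
pose w k := extvec (row k A) * extvec (row k B).
have comm k z : w k * extvec z = extvec z * w k.
  rewrite /w -mulrA [extvec _ * extvec z]extvecN mulrN 2!mulrA.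
  by rewrite [extvec _ * extvec z]extvecN mulNr opprK.
have wC k l : w k * w l = w l * w k.
  by rewrite {2}/w mulrA comm -mulrA comm mulrA.
have w2 k : w k * w k = 0.
  by rewrite {2}/w mulrA comm /w mulrA extvec_sq !mul0r.
have r_uniq : uniq r by apply: allpairs_uniq => //; [exact: enum_uniq | case=> ? ? [? ?]].
have r_full t : t \in r.
  by case: t => k b; apply/allpairsP; exists (k, b); rewrite mem_enum !inE; case: b.
have vol : \prod_(i <- enum 'I_n) w i = \prod_(t <- r) extvec (x t).
  rewrite /r big_allpairs_dep; apply: eq_bigr => i _.
  by rewrite !big_cons big_nil /= mulr1.
have vol0 : \prod_(i <- enum 'I_n) w i != 0.
  rewrite vol; apply: ext_volume_neq0 => //.
    by rewrite card_prod card_ord card_bool muln2 addnn.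
  move=> k; exists (fun t => invmx (col_mx A B) k
    (if t.2 then rshift n t.1 else lshift n t.1)).
  have -> : delta_mx 0 k = row k (invmx (col_mx A B) *m col_mx A B).
    by rewrite mulVmx // row1.
  rewrite row_mul mulmx_sum_row big_split_ord /= -(pair_bigA _ (fun i b =>
     (invmx (col_mx A B)) k (if b then rshift n i else lshift n i) *: x (i, b))) /=.
  rewrite -big_split /=; apply: eq_bigr => i _.
  by rewrite big_bool /= !mxE /x /= rowKu rowKd addrC.
have bE (e : 'I_n -> F) : bivec (\sum_i e i *: wedge2 (row i A) (row i B)) =
    \sum_i e i *: w i.
  by rewrite linear_sum; apply: eq_bigr => i _; rewrite linearZ /= bivec_wedge2.
have PE1 : P = \sum_i 1 *: wedge2 (row i A) (row i B).
  by rewrite PE; apply: eq_bigr => i _; rewrite scale1r.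
rewrite !extpowE PE1 QE !bE.
have -> : \sum_i 1 *: w i = \sum_i w i by apply: eq_bigr => i _; rewrite scale1r.
have en k : k \in enum 'I_n by rewrite mem_enum.
have := exp_mul_exp (enum_uniq 'I_n) en wC w2 c.
move=> /(_ (n - j)%N j); rewrite card_ord subnKC // => /(_ erefl) E.
rewrite extprodE E.
(* With exponent 0 on the weighted factor, the same formula gives the n-th power of P as n! times
   the volume: the only subset is the empty one, with product 1. *)
have := exp_mul_exp (enum_uniq 'I_n) en wC w2 (fun=> 0).
move=> /(_ n 0%N); rewrite card_ord add0n => /(_ erefl).
rewrite expr0 mul1r => ->.
rewrite scalerA => /eqP; rewrite -subr_eq0 -scalerBl scaler_eq0 (negPf vol0) orbF subr_eq0.
rewrite (big_pred1 finset.set0) => [|I]; last by rewrite cards_eq0.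
rewrite big_set0 mulr1 fact0 mul1n -(bin_fact jn) => /eqP.
rewrite mulrC natrM -mulrA mulrCA => /mulfI -> //.
by rewrite pnatr_eq0 -lt0n muln_gt0 !fact_gt0.
Qed.

(** In coordinates (q, p), the components of the bivector sum_i c_i d/dq_i /\ d/dp_i; constant
    weights 1 give the canonical one. *)
Definition symp n (F : nzRingType) (c : 'rV[F]_n) : 'M[F]_(n + n) :=
  block_mx 0 (diag_mx c) (- diag_mx c) 0.

Lemma sympE n (F : comNzRingType) (c : 'rV[F]_n) m (A B : 'M[F]_(n, m)) :
  (col_mx A B)^T *m symp c *m col_mx A B =
  \sum_i c 0 i *: wedge2 (row i A) (row i B).
Proof.
have E (X Y : 'M[F]_(n, m)) k l :
    (X^T *m diag_mx c *m Y) k l = \sum_i c 0 i * (X i k * Y i l).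
  rewrite mul_mx_diag mxE; apply: eq_bigr => i _.
  by rewrite !mxE mulrAC mulrC.
rewrite tr_col_mx mul_row_block !mulmx0 add0r addr0 mul_row_col mulmxN mulNmx.
apply/matrixP => k l; rewrite summxE mxE [X in X + _]mxE !E addrC -sumrN -big_split /=.
by apply: eq_bigr => i _; rewrite !mxE !big_ord1 !mxE mulrBr [B i k * _]mulrC.
Qed.

Lemma symp_unit n (F : fieldType) (c : 'rV[F]_n) :
  (forall i, c 0 i != 0) -> symp c \in unitmx.
Proof.
move=> c0; pose d : 'rV[F]_n := \row_i (c 0 i)^-1.
suff /mulmx1_unit[] : symp c *m (- symp d) = 1%:M by [].
have cd : diag_mx c *m diag_mx d = 1%:M.
  apply/matrixP => i j; rewrite mul_diag_mx !mxE; case: eqP => [->|]; rewrite ?mulr0n ?mulr0 //.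
  by rewrite mulr1n mulfV.
rewrite mulmxN mulmx_block !(mul0mx, mulmx0, add0r, addr0) mulmxN mulNmx cd.
by rewrite opp_block_mx !opprK !oppr0 -scalar_mx_block.
Qed.

(* The rows of [X], [Ph], [Th] are the differentials of x_i, phi_i and
   log (1 + |y_i|^2), those of [Y^T] the differentials of Re y_i, Im y_i; the
   rows of [col_mx A B] are the frame dual to the c_k and their conjugate angles. *)
Lemma simultaneous_darboux (F : numFieldType) n (X Ph Th : 'M[F]_(n, n + n))
    (L : 'M[F]_n) (c p p' u v s : 'rV[F]_n) (Om P Q : 'M[F]_(n + n)) :
  L \in unitmx -> (forall i, c 0 i != 0) -> (forall i, s 0 i != 0) ->
  Om = X^T *m Ph - Ph^T *m X -> P^T *m Om = 1%:M ->
  L *m X = - (diag_mx c *m L *m Th) ->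
  (forall i, p 0 i * u 0 i + p' 0 i * v 0 i = - s 0 i) ->
  let Y := (col_mx (diag_mx p *m Th - diag_mx v *m Ph)
                   (diag_mx p' *m Th + diag_mx u *m Ph))^T in
  Q = (invmx Y)^T *m symp s *m invmx Y ->
  exists A B : 'M[F]_(n, n + n), [/\ col_mx A B \in unitmx,
    P = \sum_i wedge2 (row i A) (row i B) &
    Q = \sum_i c 0 i *: wedge2 (row i A) (row i B)].
Proof.
move=> Lu c0 s0 OmE POm LX pu Y QE.
(* Differentials of the conjugate angles: a change of momenta by [L] is compensated by the inverse
   transpose of [L] on the angles. *)
pose Ps : 'M_(n, n + n) := invmx L^T *m Ph.
pose D := col_mx (L *m X) Ps.
have sympT (e : 'rV[F]_n) : (symp e)^T = - symp e.
  by rewrite /symp tr_block_mx linearN /= tr_diag_mx !trmx0 opp_block_mx opprK !oppr0.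
pose one : 'rV[F]_n := const_mx 1.
have diag1 : diag_mx one = 1%:M :> 'M[F]_n by apply/matrixP => i j; rewrite !mxE.
have LTu : L^T \in unitmx by rewrite unitmx_tr.
have OmD : Om = D^T *m symp one *m D.
  rewrite tr_col_mx mul_row_block !mulmx0 add0r addr0 mul_row_col mulmxN mulNmx diag1 !mulmx1.
  rewrite /Ps !trmx_mul trmx_inv trmxK -!mulmxA (mulKmx Lu) (mulKVmx LTu) OmE.
  by rewrite addrC.
have [P_unit Om_unit] := mulmx1_unit POm.
have Du : D \in unitmx.
  by move: Om_unit; rewrite OmD unitmx_mul => /andP[].
pose E := invmx D.
have J2 : symp one *m symp one = - 1%:M.
  rewrite /symp diag1 mulmx_block !(mul0mx, mulmx0, add0r, addr0, mulmx1, mul1mx).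
  by rewrite scalar_mx_block opp_block_mx oppr0.
(* Two signs cancel: the inverse of [symp one] is its opposite, and so is its transpose, which
   enters through [P^T]. *)
have PD : P = E *m symp one *m E^T.
  apply: trmx_inj; apply: (can_inj (mulmxK Om_unit)); rewrite POm OmD.
  rewrite !trmx_mul trmxK sympT !(mulmxN, mulNmx) !mulmxA -[_ *m E^T *m D^T]mulmxA.
  rewrite -trmx_mul mulmxV // trmx1 mulmx1 -[_ *m symp one *m symp one]mulmxA J2.
  by rewrite mulmxN mulNmx opprK mulmx1 mulVmx.
(* The candidate for [Q]; equality will follow from equal brackets of the functions Re y_i and Im
   y_i. *)
pose Q' := E *m symp c *m E^T.
have DQ : D *m Q' *m D^T = symp c.
  rewrite /Q' !mulmxA mulmxV // mul1mx -mulmxA -trmx_mul mulmxV //.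
  by rewrite trmx1 mulmx1.
(* The four blocks are the brackets under [Q'] of the c_k and their conjugate angles. *)
have := DQ; rewrite {1}/D tr_col_mx mul_col_mx mul_col_row => /eq_block_mx[q11 q12 q21 q22].
have cu : diag_mx c \in unitmx.
  by rewrite unitmxE det_diag unitfE; apply/prodf_neq0.
pose N := invmx (diag_mx c *m L).
have cLu : diag_mx c *m L \in unitmx by rewrite unitmx_mul cu.
have ThE : Th = - N *m (L *m X) by rewrite LX mulmxN mulNmx opprK mulKmx.
have PhE : Ph = L^T *m Ps by rewrite mulKVmx.
have qM (a b : 'M_n) (x y : 'M_(n, n + n)) :
    (a *m x) *m Q' *m (b *m y)^T = a *m (x *m Q' *m y^T) *m b^T.
  by rewrite trmx_mul !mulmxA.
have qTT : Th *m Q' *m Th^T = 0 by rewrite ThE qM q11 mulmx0 mul0mx.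
have qPP : Ph *m Q' *m Ph^T = 0 by rewrite PhE qM q22 mulmx0 mul0mx.
(* Here the weights cancel: [Th] carries the inverse of [diag_mx c *m L], while the bracket of c
   with the angles phi is [diag_mx c *m L]. *)
have qTP : Th *m Q' *m Ph^T = - 1%:M.
  by rewrite ThE PhE qM q12 trmxK !mulNmx -mulmxA mulVmx.
have qPT : Ph *m Q' *m Th^T = 1%:M.
  rewrite ThE PhE qM q21 !(mulmxN, mulNmx, raddfN) /= opprK -[diag_mx c]tr_diag_mx.
  by rewrite -!trmx_mul mulVmx // trmx1.
have qq (a b a' b' : 'M_n) : (a *m Th + b *m Ph) *m Q' *m (a' *m Th + b' *m Ph)^T =
    b *m a'^T - a *m b'^T.
  rewrite linearD /= !mulmxDl !mulmxDr (qM a a') (qM a b') (qM b a') (qM b b').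
  rewrite qTT qPP qTP qPT !(mulmx0, mul0mx, mulmxN, mulNmx, mulmx1).
  by rewrite add0r addr0 addrC.
have vT : (- diag_mx v)^T = - diag_mx v by rewrite linearN /= tr_diag_mx.
have YQ : Y^T *m Q' *m Y = symp s.
  rewrite trmxK -[Y]/(_^T) tr_col_mx mul_col_mx mul_col_row -mulNmx !qq vT.
  rewrite !tr_diag_mx !(mulNmx, mulmxN, mulmx_diag).
  have sE i : s 0 i = - (p 0 i * u 0 i + p' 0 i * v 0 i) by rewrite pu opprK.
  by congr block_mx; apply/matrixP => i j; rewrite !mxE ?sE;
    case: (i =P j) => _; rewrite ?mulr1n ?mulr0n; ring.
have su := symp_unit s0.
(* Invertibility of the Jacobian of the y coordinates is read off from that of their bracket
   matrix. *)
have Yu : Y \in unitmx.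
  by move: su; rewrite -YQ unitmx_mul => /andP[].
have QQ : Q = Q'.
  rewrite QE -YQ !mulmxA -trmx_mul mulmxV // trmx1 mul1mx -mulmxA mulmxV //.
  by rewrite mulmx1.
exists (usubmx E^T), (dsubmx E^T); split.
- by rewrite vsubmxK unitmx_tr unitmx_inv.
- have := sympE one (usubmx E^T) (dsubmx E^T); rewrite vsubmxK trmxK -PD => ->.
  by apply: eq_bigr => i _; rewrite mxE scale1r.
- by rewrite QQ -sympE vsubmxK trmxK.
Qed.

From mathcomp Require Import all_classical all_reals all_analysis.
From mathcomp Require Import complex.
Import numFieldNormedType.Exports.
Import ComplexField.Normc.
Local Open Scope ring_scope.

(** * Momentum and Bruhat coordinates on the chart {Z_0 <> 0} *)

Lemma normc2E (R : rcfType) (z : R[i]) :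
  normc z ^+ 2 = complex.Re z ^+ 2 + complex.Im z ^+ 2.
Proof. by case: z => a b; rewrite /normc sqr_sqrtr ?addr_ge0 ?sqr_ge0. Qed.

(** With y = a + i b, i d/dy /\ d/dybar = - 1/2 d/da /\ d/db, which is the origin of the factor -1/2
    in the weights. *)
Lemma bruhat_real (R : realType) n (pi : tensor2 R n) (w : 'rV[R]_(n + n)) :
  bruhat pi ->
  let F := invmx (jacobian (fun v => realify (ycoord v)) w) in
  pi ord0 w =
    F^T *m symp (\row_i - (2^-1 * (1 + normc (ycoord w i) ^+ 2))) *m F.
Proof.
move=> [_ /(_ w) piE] F.
rewrite -[X in _ *m X](vsubmxK F) -{1}(vsubmxK F) sympE.
apply: (@map_mx_inj _ _ (real_complex R)); rewrite piE scaler_sumr [RHS]raddf_sum.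
apply: eq_bigr => i _; rewrite [X in _ = _ (X *: _)]mxE.
move: (normc _ ^+ 2) => y.
apply/matrixP => k l; rewrite !mxE !big_ord1 !mxE.
move: (F (lshift n i) k) (F (rshift n i) k) (F (lshift n i) l) (F (rshift n i) l).
move=> a b c d.
rewrite !(rmorphM, rmorphN, rmorphB, rmorphD, fmorphV, rmorph_nat) /=.
(* To [field] the imaginary unit is an indeterminate, so its square is isolated before being
   replaced by -1. *)
rewrite [LHS](_ : _ = 'i%C ^+ 2 * (2^-1 * (1 + y%:C%C) *
  (a%:C%C * d%:C%C - b%:C%C * c%:C%C))); last by field.
rewrite sqr_i mulN1r -mulNr.
by rewrite !(rmorphM, rmorphN, rmorphB, rmorphD, fmorphV, rmorph_nat, rmorph1).
Qed.

Section ChartZero.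
Variables (R : realType) (n : nat).
Implicit Types (v w e : 'rV[R]_(n + n)) (i : 'I_n) (k : nat).

Definition zsq i v : R := v 0 (lshift n i) ^+ 2 + v 0 (rshift n i) ^+ 2.

(** With indices from 0 this is T_(k+1); in particular [zsq_tail 0] is the common denominator
    T_1. *)
Definition zsq_tail k v : R := 1 + \sum_(i < n | (k <= i)%N) zsq i v.

Lemma zsqE i v : normc (zcoord v i) ^+ 2 = zsq i v.
Proof. by rewrite normc2E. Qed.

Lemma zsq_ge0 i v : 0 <= zsq i v.
Proof. by rewrite addr_ge0 // sqr_ge0. Qed.

Lemma zsq_neq0 i v : zcoord v i != 0 -> zsq i v != 0.
Proof.
apply: contraNneq => /eqP; rewrite paddr_eq0 ?sqr_ge0 // !sqrf_eq0 /zcoord.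
by move=> /andP[/eqP -> /eqP ->].
Qed.

Lemma zsq_tail_gt0 k v : 0 < zsq_tail k v.
Proof. by rewrite ltr_pwDl // sumr_ge0 // => i _; apply: zsq_ge0. Qed.

Lemma zsq_tail_neq0 k v : zsq_tail k v != 0.
Proof. by rewrite gt_eqF ?zsq_tail_gt0. Qed.

Lemma zsq_tailS i v : zsq_tail i v = zsq i v + zsq_tail i.+1 v.
Proof.
rewrite /zsq_tail (bigD1 i) //= addrCA; congr (_ + (_ + _)).
by apply: eq_bigl => j; rewrite ltn_neqAle eq_sym andbC.
Qed.

(** [momentum] is computed on an arbitrary generator of the line; up to a nonzero factor, which
    cancels there, it is the normalized one. *)
Lemma vpick_line (F : fieldType) (V : vectType F) (z : V) : z != 0 ->
  exists2 c, c != 0 & vpick <[z]>%VS = c *: z.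
Proof.
move=> z0; have /vlineP[c cE] := memv_pick <[z]>%VS.
exists c => //; apply: contraNneq z0 => c0.
have := vpick0 <[z]>%VS; rewrite cE c0 scale0r eqxx.
by move/esym; rewrite -dimv_eq0 dim_vline eqb0 negbK.
Qed.

Lemma homog_neq0 a v : homog a v != 0.
Proof.
by apply/eqP => /rowP /(_ a); rewrite !mxE unlift_none => /eqP; rewrite oner_eq0.
Qed.

Lemma momentum_chart i a v : momentum i (chart_point a v) =
  (i == 0%N :> nat)%:R
  - normc (homog a v 0 (lift ord0 i)) ^+ 2 / \sum_k normc (homog a v 0 k) ^+ 2.
Proof.
rewrite /momentum /chart_point /=.
have [c c0 ->] := vpick_line (homog_neq0 a v).
have nc0 : normc c ^+ 2 != 0.
  by rewrite sqrf_eq0; apply: contraNneq c0 => /eq0_normc ->.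
under eq_bigr do rewrite mxE normcM exprMn.
by rewrite -mulr_sumr mxE normcM exprMn -mulf_div divff ?mul1r.
Qed.

Lemma homog0S v i : homog ord0 v 0 (lift ord0 i) = zcoord v i.
Proof. by rewrite mxE liftK. Qed.

Lemma momentum_chart0 i v : momentum i (chart_point ord0 v) =
  (i == 0%N :> nat)%:R - zsq i v / zsq_tail 0 v.
Proof.
rewrite momentum_chart homog0S zsqE; congr (_ - _ / _).
rewrite big_ord_recl mxE unlift_none normc2E /= expr0n addr0 expr1n.
by congr (_ + _); apply: eq_bigr => j _; rewrite homog0S zsqE.
Qed.

Lemma csum_chart0 i v :
  csum i (chart_point ord0 v) = zsq_tail i.+1 v / zsq_tail 0 v.
Proof.
rewrite /csum; under eq_bigr do rewrite momentum_chart0.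
(* The shift delta_(1,i) occurs exactly once in each partial sum; the resulting 1 minus the head of
   the sum leaves the tail. *)
rewrite sumrB -mulr_suml (bigD1 (Ordinal (leq_ltn_trans (leq0n i) (ltn_ord i)))) //=.
rewrite [X in _ + X - _]big1 => [|j /andP[_]]; last by rewrite -val_eqE /= => /negPf ->.
rewrite addr0; apply/esym/(canLR (mulfK (zsq_tail_neq0 0 v))).
rewrite mulrBl mul1r mulfVK ?zsq_tail_neq0 //; apply/esym/eqP.
rewrite subr_eq /zsq_tail [X in 1 + X == _](bigID (fun j : 'I_n => (j <= i)%N)) /=.
rewrite addrCA [X in _ == X]addrC; apply/eqP; congr (_ + (_ + _)).
by apply: eq_bigl => j; rewrite -ltnNge.
Qed.

End ChartZero.

(** * Differentials of the coordinates *)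

Lemma differentiable_real_comp (R : realType) (V : normedModType R) (f : V -> R)
    (g : R -> R) (x : V) (dg : R) :
  differentiable f x -> is_derive (f x) 1 g dg ->
  differentiable (fun y => g (f y)) x.
Proof.
move=> df [g1 _]; apply: (@differentiable_comp _ _ _ _ f g) => //.
exact/derivable1_diffP.
Qed.

Lemma is_derive_real_comp (R : realType) (V : normedModType R) (f : V -> R)
    (g : R -> R) (x e : V) (dg : R) :
  differentiable f x -> is_derive (f x) 1 g dg ->
  is_derive x e (fun y => g (f y)) (dg * 'D_e f x).
Proof.
move=> df gP; have dgf := differentiable_real_comp df gP.
split; first exact: diff_derivable.
have [g1 gE] := gP; have dg1 : differentiable g (f x) by exact/derivable1_diffP.
rewrite deriveE // (diff_comp df dg1) /= diff1E // deriveE // derive1E gE.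
by rewrite mulrC.
Qed.

Lemma differentiable_row (R : realType) (V : normedModType R) m (f : V -> 'rV[R]_m) (x : V) :
  (forall j, differentiable (fun v => f v 0 j) x) -> differentiable f x.
Proof.
move=> df.
have -> : f = \sum_(j < m) (fun v => f v 0 j *: delta_mx 0 j).
  by apply/funext => v; rewrite fct_sumE -row_sum_delta.
by apply: differentiable_sum => j; apply: differentiableZl.
Qed.

Lemma jacobianE (R : realType) m p (f : 'rV[R]_m -> 'rV[R]_p) (x : 'rV[R]_m) k l :
  differentiable f x -> jacobian f x k l = 'D_(delta_mx 0 k) (fun v => f v 0 l) x.
Proof.
move=> df; have := deriveEjacobian (delta_mx 0 k) df.
rewrite -rowE derive_mx; last exact: diff_derivable.
by move=> /rowP /(_ l); rewrite !mxE.
Qed.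

Lemma sum_ord_telescope (V : zmodType) n (g : nat -> V) (k : 'I_n) :
  \sum_(j < n | (j <= k)%N) (g j - g j.+1) = g 0%N - g k.+1.
Proof.
rewrite -(big_ord_widen n (fun j => g j - g j.+1) (ltn_ord k)).
rewrite -(big_mkord xpredT (fun j => g j - g j.+1)) -opprB -(telescope_sumr g (leq0n _)).
by rewrite -sumrN; apply: eq_bigr => j _; rewrite opprB.
Qed.

Section ChartZeroCalculus.
Variables (R : realType) (n : nat) (w : 'rV[R]_(n + n)).
Implicit Types (v e : 'rV[R]_(n + n)) (i : 'I_n) (k : nat).

Lemma differentiable_entry m (u : 'rV[R]_m) (j : 'I_m) :
  differentiable (fun v : 'rV[R]_m => v 0 j : R) u.
Proof. exact: differentiable_coord. Qed.

Lemma is_derive_entry m (u d : 'rV[R]_m) (j : 'I_m) :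
  is_derive u d (fun v : 'rV[R]_m => v 0 j : R) (d 0 j).
Proof.
split; first exact/diff_derivable/differentiable_entry.
by rewrite -{2}(derive_id u d) derive_mx ?mxE //; apply: derivable_id.
Qed.

Definition zsq_der i e : R :=
  2 * (w 0 (lshift n i) * e 0 (lshift n i) + w 0 (rshift n i) * e 0 (rshift n i)).

Definition tail_der k e : R := \sum_(i < n | (k <= i)%N) zsq_der i e.

Lemma zsqfE i : @zsq R n i =
  (fun v => v 0 (lshift n i)) ^+ 2 + (fun v => v 0 (rshift n i)) ^+ 2.
Proof. by apply/funext => v; rewrite !fctE. Qed.

Lemma zsq_tailfE k : @zsq_tail R n k =
  cst 1 + \sum_(i < n) (if (k <= i)%N then @zsq R n i else cst 0).
Proof.
apply/funext => v; rewrite fctE /zsq_tail fct_sumE big_mkcond; congr (_ + _).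
by apply: eq_bigr => i _; case: ifP.
Qed.

Lemma differentiable_zsq i : differentiable (@zsq R n i) w.
Proof.
rewrite zsqfE; apply: differentiableD; apply: differentiableX;
  exact: differentiable_entry.
Qed.

Lemma differentiable_zsq_tail k : differentiable (@zsq_tail R n k) w.
Proof.
rewrite zsq_tailfE; apply: differentiableD; first exact: differentiable_cst.
apply: differentiable_sum => i; case: ifP => _; first exact: differentiable_zsq.
exact: differentiable_cst.
Qed.

Lemma is_derive_zsq i e : is_derive w e (@zsq R n i) (zsq_der i e).
Proof.
rewrite zsqfE; have dE := is_derive_entry w e.
have := is_deriveD (is_deriveX 2 (dE (lshift n i))) (is_deriveX 2 (dE (rshift n i))).
by congr is_derive; rewrite /zsq_der !expr1 /GRing.scale /=; ring.
Qed.

Lemma is_derive_zsq_tail k e : is_derive w e (@zsq_tail R n k) (tail_der k e).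
Proof.
rewrite zsq_tailfE.
have F i : is_derive w e (if (k <= i)%N then @zsq R n i else cst 0)
    (if (k <= i)%N then zsq_der i e else 0).
  by case: ifP => _; [exact: is_derive_zsq | exact: is_derive_cst].
have := is_deriveD (is_derive_cst (1 : R) w e) (is_derive_sum F).
by congr is_derive; rewrite add0r /tail_der [RHS]big_mkcond.
Qed.

Lemma tail_derS i e : tail_der i e = zsq_der i e + tail_der i.+1 e.
Proof.
rewrite /tail_der (bigD1 i) //=; congr (_ + _).
by apply: eq_bigl => j; rewrite ltn_neqAle eq_sym andbC.
Qed.

Lemma derive_momentum i e :
  'D_e (fun v => momentum i (chart_point ord0 v)) w =
  - (zsq_der i e / zsq_tail 0 w - zsq i w * tail_der 0 e / zsq_tail 0 w ^+ 2).
Proof.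
have -> : (fun v => momentum i (chart_point ord0 v)) =
    cst ((i == 0%N :> nat)%:R) - @zsq R n i * (fun v => (zsq_tail 0 v)^-1).
  by apply/funext => v; rewrite momentum_chart0 !fctE.
have T0 := zsq_tail_neq0 0 w.
have dz := is_derive_zsq i e; have dt := is_derive_zsq_tail 0 e.
have dV : is_derive w e (fun v => (zsq_tail 0 v)^-1)
   (- zsq_tail 0 w ^- 2 *: tail_der 0 e).
  by have [t1 <-] := dt; split; [exact: derivableV | rewrite deriveV].
have := is_deriveB (is_derive_cst ((i == 0%N :> nat)%:R : R) w e) (is_deriveM dz dV).
move=> [_ ->]; rewrite /GRing.scale /=.
by field.
Qed.

(** The modulus is eliminated first: Re z_i sin phi_i = Im z_i cos phi_i holds near [w], and it is
    this identity that is differentiated. *)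
Lemma derive_angle (phi : 'I_n -> 'rV[R]_(n + n) -> R) i e : local_angles phi w ->
  zsq i w * 'D_e (phi i) w =
  w 0 (lshift n i) * e 0 (rshift n i) - w 0 (rshift n i) * e 0 (lshift n i).
Proof.
move=> /(_ i)[dphi near_phi].
pose f j (v : 'rV[R]_(n + n)) : R := v 0 j.
have eq_near : \near w, (f (lshift n i) * (fun v => sin (phi i v))) w
                      = (f (rshift n i) * (fun v => cos (phi i v))) w.
  near=> v; rewrite !fctE /f.
  have : zcoord v i = (normc (zcoord v i))%:C%C
                   * Complex (cos (phi i v)) (sin (phi i v)) by near: v.
  move: (normc _) => r /eqP.
  rewrite eq_complex /= !mul0r subr0 addr0 => /andP[/eqP -> /eqP ->].
  by rewrite mulrAC.
have := nbhs_singleton near_phi; move: (normc _) => r /eqP.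
rewrite eq_complex /= !mul0r subr0 addr0 => /andP[/eqP wl /eqP wr].
have ds := is_derive_real_comp e dphi (is_derive_sin (phi i w)).
have dc := is_derive_real_comp e dphi (is_derive_cos (phi i w)).
have dl := is_derive_entry w e (lshift n i).
have dr := is_derive_entry w e (rshift n i).
have := near_eq_derive e eq_near.
have [_ ->] := is_deriveM dl ds; have [_ ->] := is_deriveM dr dc.
rewrite /GRing.scale /=.
set dphi_e := 'D_e _ w => E.
rewrite /f wl wr in E; rewrite /zsq wl wr.
move/eqP: E; rewrite -subr_eq0 => /eqP E.
(* The difference of the two sides is the modulus [r] times the differentiated identity. *)
apply/eqP; rewrite -subr_eq0; apply/eqP; rewrite -[RHS](mulr0 r) -E.
by ring.
Unshelve. all: by end_near. Qed.

(** * The coordinates y_i and their derivatives *)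

Definition rsqrt_tail k v : R := (Num.sqrt (zsq_tail k v))^-1.

Lemma rsqrt_tail_sqr k v : rsqrt_tail k v ^+ 2 = (zsq_tail k v)^-1.
Proof. by rewrite exprVn sqr_sqrtr // ltW ?zsq_tail_gt0. Qed.

Lemma ycoordE v i : ycoord v i = Complex (v 0 (lshift n i) * rsqrt_tail i.+1 v)
                                         (v 0 (rshift n i) * rsqrt_tail i.+1 v).
Proof.
rewrite /ycoord; under eq_bigr do rewrite zsqE.
rewrite -/(zsq_tail i.+1 v) -fmorphV /rsqrt_tail; move: (_^-1) => r.
by apply/eqP; rewrite eq_complex /= !mulr0 subr0 add0r !eqxx.
Qed.

Lemma normc_ycoord v i : 1 + normc (ycoord v i) ^+ 2 = zsq_tail i v / zsq_tail i.+1 v.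
Proof.
rewrite ycoordE normc2E /= !exprMn -mulrDl rsqrt_tail_sqr -/(zsq i v).
by rewrite zsq_tailS [RHS]mulrDl divff ?zsq_tail_neq0 // addrC.
Qed.

Lemma realify_lshift (z : 'I_n -> R[i]) i : realify z 0 (lshift n i) = complex.Re (z i).
Proof. by rewrite row_mxEl mxE. Qed.

Lemma realify_rshift (z : 'I_n -> R[i]) i : realify z 0 (rshift n i) = complex.Im (z i).
Proof. by rewrite row_mxEr mxE. Qed.

Lemma is_derive_rsqrt (x : R) : 0 < x ->
  is_derive x 1 (fun y => (Num.sqrt y)^-1) (- (Num.sqrt x)^-1 / (2 * x)).
Proof.
move=> x0; have [s1 s2] := is_derive1_sqrt x0.
have sx0 : Num.sqrt x != 0 by rewrite gt_eqF // sqrtr_gt0.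
split; first exact: derivableV.
rewrite deriveV // s2 /GRing.scale /=.
have -> : 2 * x = 2 * Num.sqrt x ^+ 2 by rewrite sqr_sqrtr // ltW.
by field.
Qed.

Lemma differentiable_rsqrt_tail k : differentiable (rsqrt_tail k) w.
Proof.
exact: (differentiable_real_comp (differentiable_zsq_tail k)
          (is_derive_rsqrt (zsq_tail_gt0 k w))).
Qed.

Lemma is_derive_rsqrt_tail k e :
  is_derive w e (rsqrt_tail k) (- rsqrt_tail k w / (2 * zsq_tail k w) * tail_der k e).
Proof.
have := is_derive_real_comp e (differentiable_zsq_tail k)
  (is_derive_rsqrt (zsq_tail_gt0 k w)).
by have [_ ->] := is_derive_zsq_tail k e.
Qed.

Lemma is_derive_y (j : 'I_(n + n)) k e :
  is_derive w e (fun v => v 0 j * rsqrt_tail k v)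
    (e 0 j * rsqrt_tail k w -
     w 0 j * rsqrt_tail k w / (2 * zsq_tail k w) * tail_der k e).
Proof.
have := is_deriveM (is_derive_entry w e j) (is_derive_rsqrt_tail k e).
by congr is_derive; rewrite /GRing.scale /=; ring.
Qed.

Lemma ychart_lshift i : (fun v => realify (ycoord v) 0 (lshift n i)) =
  (fun v => v 0 (lshift n i) * rsqrt_tail i.+1 v).
Proof. by apply/funext => v; rewrite realify_lshift ycoordE. Qed.

Lemma ychart_rshift i : (fun v => realify (ycoord v) 0 (rshift n i)) =
  (fun v => v 0 (rshift n i) * rsqrt_tail i.+1 v).
Proof. by apply/funext => v; rewrite realify_rshift ycoordE. Qed.

Lemma differentiable_ychart : differentiable (fun v => realify (ycoord v)) w.
Proof.
have dM j k : differentiable (fun v => v 0 j * rsqrt_tail k v) w.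
  by apply: differentiableM;
    [exact: differentiable_entry | exact: differentiable_rsqrt_tail].
apply: differentiable_row => j.
by case: (split_ordP j) => i ->; rewrite ?ychart_lshift ?ychart_rshift.
Qed.

Hypothesis w_neq0 : forall i, zcoord w i != 0.

Lemma chart0_darboux (omega pi_s pi_inf : tensor2 R n) :
  fubini_study omega -> dual_bivector omega pi_s -> bruhat pi_inf ->
  exists A B : 'M[R]_(n, n + n), [/\ col_mx A B \in unitmx,
    pi_s ord0 w = \sum_i wedge2 (row i A) (row i B) &
    pi_inf ord0 w =
      \sum_i csum i (chart_point ord0 w) *: wedge2 (row i A) (row i B)].
Proof.
move=> [_ /(_ w w_neq0)[phi [phiP omE]]] [_ /(_ ord0 w) POm] piP.
pose T k := zsq_tail k w.
have T0 k : T k != 0 by exact: zsq_tail_neq0.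
have N0 i : zsq i w != 0 by exact: zsq_neq0.
pose E (l : 'I_(n + n)) : 'rV[R]_(n + n) := delta_mx 0 l.
pose X : 'M[R]_(n, n + n) := \matrix_(i, l)
  'D_(E l) (fun v => momentum i (chart_point ord0 v)) w.
pose Ph : 'M[R]_(n, n + n) := \matrix_(i, l) 'D_(E l) (phi i) w.
(* The logarithmic derivative of 1 + |y_i|^2 = T i / T i.+1, written out. *)
pose Th : 'M[R]_(n, n + n) := \matrix_(i, l)
  (tail_der i (E l) / T i - tail_der i.+1 (E l) / T i.+1).
pose L : 'M[R]_n := \matrix_(j, i) (i <= j)%N%:R.
pose c : 'rV[R]_n := \row_i csum i (chart_point ord0 w).
pose s : 'rV[R]_n := \row_i - (2^-1 * (1 + normc (ycoord w i) ^+ 2)).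
pose u : 'rV[R]_n := \row_i (w 0 (lshift n i) * rsqrt_tail i.+1 w).
pose v : 'rV[R]_n := \row_i (w 0 (rshift n i) * rsqrt_tail i.+1 w).
(* This is (1 + |y_i|^2) / (2 |y_i|^2), the factor in d log |y_i| = h i * d log (1 + |y_i|^2); hence
   [p] and [p'] are the components of d Re y_i and d Im y_i along the latter. *)
pose h i := T i / (2 * zsq i w).
pose p : 'rV[R]_n := \row_i (u 0 i * h i).
pose p' : 'rV[R]_n := \row_i (v 0 i * h i).
have [] := @simultaneous_darboux R n X Ph Th L c p p' u v s
  (omega ord0 w) (pi_s ord0 w) (pi_inf ord0 w).
- rewrite unitmxE det_trig => [|]; last first.
    by apply/is_trig_mxP => i j ij; rewrite mxE leqNgt ij.
  by rewrite big1 ?unitr1 // => i _; rewrite mxE leqnn.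
- by move=> i; rewrite mxE csum_chart0 mulf_neq0 ?invr_neq0 ?zsq_tail_neq0.
- by move=> i; rewrite mxE normc_ycoord oppr_eq0 !mulf_neq0 ?invr_neq0 ?pnatr_eq0 ?zsq_tail_neq0.
- rewrite omE; apply/matrixP => k l; rewrite summxE !mxE -sumrN -big_split /=.
  by apply: eq_bigr => i _; rewrite !mxE !big_ord1 !mxE.
- by [].
- apply/matrixP => k l; rewrite -mulmxA mul_diag_mx !mxE csum_chart0.
  have sumL (F : 'I_n -> R) : \sum_j L k j * F j = \sum_(j < n | (j <= k)%N) F j.
    rewrite [RHS]big_mkcond; apply: eq_bigr => j _; rewrite mxE.
    by case: ifP; rewrite ?mul1r ?mul0r.
  under eq_bigr => j _ do rewrite [X j l]mxE derive_momentum.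
  under [in RHS]eq_bigr => j _ do rewrite [Th j l]mxE.
  rewrite !sumL; set d := tail_der ^~ (E l).
  (* Both sums telescope: the right one in the derivatives of log T_j, the left one in [G j], the
     derivative of - T j / T 0. *)
  rewrite (sum_ord_telescope (fun j => d j / T j)).
  pose G j := T j * d 0%N / T 0%N ^+ 2 - d j / T 0%N.
  rewrite (eq_bigr (fun j : 'I_n => G j - G j.+1)) => [|j _]; last first.
    rewrite /G /d /T tail_derS zsq_tailS; ring.
  rewrite (sum_ord_telescope G) /G -/(T 0%N) -/(T k.+1).
  by field; rewrite ?T0.
- move=> i; rewrite !mxE normc_ycoord /h.
  rewrite opprK -/(T i) -/(T i.+1).
  transitivity (zsq i w * rsqrt_tail i.+1 w ^+ 2 * (T i / (2 * zsq i w))).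
    by rewrite /zsq; ring.
  by rewrite rsqrt_tail_sqr -/(T i.+1); field; rewrite N0 T0.
- have angle i l : 'D_(E l) (phi i) w = (w 0 (lshift n i) * E l 0 (rshift n i)
      - w 0 (rshift n i) * E l 0 (lshift n i)) / zsq i w.
    by rewrite -(derive_angle i (E l) phiP) mulrC mulKf.
  have TS i : T i = zsq i w + T i.+1 by exact: zsq_tailS.
  have -> : (col_mx (diag_mx p *m Th - diag_mx v *m Ph)
     (diag_mx p' *m Th + diag_mx u *m Ph))^T = jacobian (fun v => realify (ycoord v)) w.
    apply/matrixP => k l; rewrite jacobianE; last exact: differentiable_ychart.
    case: (split_ordP l) => i ->; rewrite mxE ?(col_mxEu, col_mxEd).
      rewrite ychart_lshift; have [_ ->] := is_derive_y (lshift n i) i.+1 (E k).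
      rewrite mul_diag_mx [diag_mx _ *m Ph]mul_diag_mx ![in LHS]mxE -/(E k).
      rewrite angle /h tail_derS -/(T i.+1).
      move: (T0 i) (T0 i.+1) (N0 i); rewrite TS /zsq_der /zsq => TS0 T10 z0.
      by field; rewrite T10 TS0 z0.
    rewrite ychart_rshift; have [_ ->] := is_derive_y (rshift n i) i.+1 (E k).
    rewrite mul_diag_mx [diag_mx _ *m Ph]mul_diag_mx ![in LHS]mxE -/(E k).
    rewrite angle /h tail_derS -/(T i.+1).
    move: (T0 i) (T0 i.+1) (N0 i); rewrite TS /zsq_der /zsq => TS0 T10 z0.
    by field; rewrite T10 TS0 z0.
  exact: bruhat_real.
move=> A [B [ABu PE QE]]; exists A, B; split=> //.
by rewrite QE; apply: eq_bigr => i _; rewrite mxE.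
Qed.

End ChartZeroCalculus.

(** * Density *)

Lemma continuous_big (T U : topologicalType) (op : U -> U -> U) (x0 : U)
    (I : Type) (r : seq I) (P : pred I) (F : I -> T -> U) :
  continuous (fun u : U * U => op u.1 u.2) ->
  (forall i, P i -> continuous (F i)) ->
  continuous (fun x => \big[op/x0]_(i <- r | P i) F i x).
Proof. by move=> opc Fc x; apply: cvg_big => // i Pi; apply: Fc. Qed.

Section Density.
Variables (R : realType) (n : nat).
Implicit Types (v w : 'rV[R]_(n + n)) (i : 'I_n) (a b k : 'I_n.+1) (p : CP R n).

Lemma zcoord_realify (z : 'I_n -> R[i]) i : zcoord (realify z) i = z i.
Proof. by rewrite /zcoord realify_lshift realify_rshift; case: (z i). Qed.

Lemma homog_realify (z : 'rV[R[i]]_n.+1) b : z 0 b != 0 ->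
  homog b (realify (fun i => z 0 (lift b i) / z 0 b)) = (z 0 b)^-1 *: z.
Proof.
move=> zb0; apply/rowP => k; rewrite !mxE.
by case: unliftP => [i ->|->]; rewrite ?zcoord_realify ?mulVf // mulrC.
Qed.

Lemma chart_point_line p b (z : 'rV[R[i]]_n.+1) :
  z 0 b != 0 -> val p = <[z]>%VS ->
  p = chart_point b (realify (fun i => z 0 (lift b i) / z 0 b)).
Proof.
move=> zb0 pz; apply/val_inj; rewrite pz /= homog_realify //.
apply/eqP; rewrite eqEsubv -!memvE memvZ ?memv_line //=.
by rewrite -[X in X \in _](scalerKV zb0) memvZ ?memv_line.
Qed.

Lemma chart_point_surj p : exists a w, p = chart_point a w.
Proof.
have /eqP dimp := valP p; set z := vpick (val p).
have z0 : z != 0 by rewrite vpick0 -dimv_eq0 dimp.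
have pz : val p = <[z]>%VS.
  apply/esym/eqP; rewrite eqEdim -memvE memv_pick dimp dim_vline.
  by case: (z != 0) z0.
have /rV0Pn[a za0] : z != 0 by [].
by exists a; eexists; apply: chart_point_line za0 pz.
Qed.

Definition all_coords_neq0 a w := forall k, homog a w 0 k != 0.

Lemma chart_point_chart0 a w : all_coords_neq0 a w ->
  exists2 v, (forall i, zcoord v i != 0) & chart_point a w = chart_point ord0 v.
Proof.
move=> w0; exists (transition a ord0 w); last exact: chart_point_line.
by move=> i; rewrite zcoord_realify mulf_neq0 ?invr_neq0.
Qed.

Lemma generic_near a w : exists e : 'rV[R]_(n + n),
  \forall t \near (0 : R)^'%classic, all_coords_neq0 a (w + t *: e).
Proof.
(* All real parts move with speed 1, so each affine coordinate vanishes for at most one value of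
   t. *)
exists (row_mx (const_mx 1) 0); near=> t => k.
rewrite mxE; case: unliftP => [i _|_]; last exact: oner_neq0.
have : w 0 (lshift n i) + t != 0.
  move: i; near: t; apply: filter_forall => i.
  have [->|wi0] := eqVneq (w 0 (lshift n i)) 0.
    by near=> t; rewrite add0r; near: t; exact: nbhs_dnbhs_neq.
  near=> t; rewrite addr_eq0; apply/eqP => wt.
  have : `|t| < `|w 0 (lshift n i)| by near: t; apply: dnbhs0_lt; rewrite normr_gt0.
  by rewrite wt normrN ltxx.
apply: contraNneq => /(congr1 (@complex.Re R)) /=.
by rewrite 2!mxE row_mxEl mxE mulr1 => ->.
Unshelve. all: by end_near. Qed.

(** Every point is a limit, along a line in one of its charts, of points with no vanishing
    homogeneous coordinate; these lie in chart 0, where F is known to vanish. *)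
Lemma eq_generic (F : CP R n -> R) :
  (forall a, continuous (fun w => F (chart_point a w))) ->
  (forall v, (forall i, zcoord v i != 0) -> F (chart_point ord0 v) = 0) ->
  forall p, F p = 0.
Proof.
move=> Fc F0 p; have [a [w ->]] := chart_point_surj p.
have [e we] := generic_near a w.
pose g (t : R) := F (chart_point a (w + t *: e)).
have gw : (g t @[t --> 0^'] --> F (chart_point a w))%classic.
  have : {for 0, continuous g}.
    apply: (@continuous_comp _ _ _ (fun t : R => w + t *: e)
              (fun v => F (chart_point a v))); last exact: Fc.
    by apply: cvgD; [exact: cvg_cst | apply: cvgZl; exact: cvg_id].
  have -> : F (chart_point a w) = g 0 by rewrite /g scale0r addr0.
  by apply: cvg_trans; apply: cvg_app; apply: cvg_within.
have g0 : (g t @[t --> 0^'] --> (0 : R))%classic.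
  have gE : \forall t \near (0 : R)^'%classic, cst 0 t = g t.
    near=> t; have [|v v0 vE] := @chart_point_chart0 a (w + t *: e); first by near: t.
    by rewrite /g vE F0.
  exact: cvg_trans (near_eq_cvg gE) (cvg_cst _).
exact: (cvg_unique _ gw g0).
Unshelve. all: by end_near. Qed.

Lemma continuous_homog_sqr a k :
  continuous (fun w => normc (homog a w 0 k) ^+ 2 : R).
Proof.
case: (unliftP a k) => [i|] ->.
  rewrite (_ : (fun w => _) = @zsq R n i); last first.
    by apply/funext => w; rewrite mxE liftK zsqE.
  by move=> w; apply: differentiable_continuous; apply: differentiable_zsq.
rewrite (_ : (fun w => _) = cst (normc (1 : R[i]) ^+ 2)).
  exact: cst_continuous.
by apply/funext => w; rewrite mxE unlift_none.
Qed.

Lemma continuous_momentum i a : continuous (fun w => momentum i (chart_point a w)).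
Proof.
pose d w : R := \sum_k normc (homog a w 0 k) ^+ 2.
have -> : (fun w => momentum i (chart_point a w)) = cst (i == 0%N :> nat)%:R
    - (fun w => normc (homog a w 0 (lift ord0 i)) ^+ 2) \* (fun w => (d w)^-1).
  by apply/funext => w; rewrite momentum_chart.
move=> w.
have dc : {for w, continuous d}.
  apply: continuous_big => [|k _ v]; first exact: add_continuous.
  exact: continuous_homog_sqr.
have dw : d w != 0.
  rewrite /d (bigD1 a) //= gt_eqF // ltr_pwDl ?sumr_ge0 // => [|k _].
    by rewrite mxE unlift_none normc2E /= expr0n addr0 expr1n.
  exact: sqr_ge0.
apply: (continuousB (@cst_continuous _ _ _ w)); apply: (continuousM _ (continuousV dw dc)).
exact: continuous_homog_sqr.
Qed.

Lemma continuous_csum i a : continuous (fun w => csum i (chart_point a w)).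
Proof.
apply: continuous_big => [|j _ w]; first exact: add_continuous.
exact: continuous_momentum.
Qed.

End Density.

Theorem theorem3p2 (R : realType) (n : nat) (n_gt0 : (0 < n)%N)
    (omega pi_s pi_inf : tensor2 R n)
    (omegaFS : fubini_study omega)
    (pi_s_dual : dual_bivector omega pi_s)
    (pi_inf_bruhat : bruhat pi_inf)
    (f : nat -> CP R n -> R)
    (fP : forall j, (1 <= j <= n)%N -> bihamiltonian_quotient pi_s pi_inf j (f j)) :
  [/\ forall j, (1 <= j <= n)%N ->
        exists a : R, a != 0 /\
          forall p, f j p =
            a * \sum_(I : {set 'I_n} | #|I| == j) \prod_(i in I) csum i p,
      exists a : R, a != 0 /\ forall p, f 1%N p = a * \sum_(i < n) csum i p
    & exists a : R, a != 0 /\ forall p, f n p = a * \prod_(i < n) csum i p].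
Proof.
have main j : (1 <= j <= n)%N -> exists a : R, a != 0 /\ forall p, f j p =
    a * \sum_(I : {set 'I_n} | #|I| == j) \prod_(i in I) csum i p.
  move=> jn; have [smooth_f fE] := fP j jn; have /andP[_ j_le_n] := jn.
  have bin0 : 'C(n, j)%:R != 0 :> R by rewrite pnatr_eq0 -lt0n bin_gt0.
  exists 'C(n, j)%:R^-1; split=> [|p]; first by rewrite invr_eq0.
  apply: (canRL (mulKf bin0)); apply/eqP; rewrite -subr_eq0; apply/eqP.
  pose e p : R := \sum_(I : {set 'I_n} | #|I| == j) \prod_(i in I) csum i p.
  have ec a : continuous (fun w => e (chart_point a w)).
    apply: continuous_big => [|I _]; first exact: add_continuous.
    apply: continuous_big => [|i _]; first exact: mul_continuous.
    exact: continuous_csum.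
  rewrite -/(e p); move: p; apply: eq_generic => [a w|w w0].
    apply: (continuousB _ (ec a w)); apply: (continuousM (@cst_continuous _ _ _ w)).
    (* Smoothness at order 0 is continuity. *)
    exact: (smooth_f a 0%N).
  have [A [B [ABu PE QE]]] := chart0_darboux w0 omegaFS pi_s_dual pi_inf_bruhat.
  apply/eqP; rewrite subr_eq0; apply/eqP.
  exact: (bihamiltonian_pencil j_le_n ABu PE QE (fE ord0 w)).
split=> //.
- have [|a [a0 aE]] := main 1%N; first by rewrite n_gt0.
  exists a; split=> // p; rewrite aE; congr (_ * _).
  rewrite (eq_bigl (fun I : {set 'I_n} => I \in [set [set i] | i : 'I_n]%SET)) => [|I]; last first.
    by apply/cards1P/imsetP => [[i ->]|[i _ ->]]; exists i.
  rewrite big_imset /=; last by move=> i j _ _ /finset.set1_inj.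
  by apply: eq_big => [i|i _]; rewrite ?inE ?big_set1.
- have [|a [a0 aE]] := main n; first by rewrite n_gt0 leqnn.
  exists a; split=> // p; rewrite aE; congr (_ * _).
  rewrite (big_pred1 finset.setT) => [|I]; last first.
    by rewrite -[X in _ == X]card_ord -cardsT (subset_leqif_cards (finset.subsetT _)).
  by apply: eq_bigl => i; rewrite inE.
Qed.
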